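(* Let $\Gamma$ be a consistent dimer model. Two internal perfect matchings of $\Gamma$ are transformed into each other by repeating mutations of perfect matchings if and only if they correspond to the same interior lattice point of the perfect matching polygon of $\Gamma$.
   Context: Dimer models. A dimer model $\Gamma$ is a finite bipartite graph on the real two-torus $\mathbb{T}=\mathbb{R}^2/\mathbb{Z}^2$ inducing a polygonal cell decomposition of $\mathbb{T}$; its nodes are coloured white and black so that every edge joins a white and a black node; $\Gamma_1$ is the set of edges and $\Gamma_2$ the set of faces. Dimer models are assumed to have no $2$-valent nodes. The associated quiver $Q=(Q_0,Q_1)$ is the dual: a vertex for each face, an arrow for each edge, crossing it so that the white node is on the right of the arrow. For a node $n$, the arrows around $n$ form a cycle $\omega_n$. Consistency. $\Gamma$ is consistent if there is $\mathsf{R}:Q_1\to\mathbb{R}_{>0}$ with $\sum_{a\in\omega_n}\mathsf{R}(a)=2$ for every node $n$, and $\sum_{\mathrm{hd}(a)=i}(1-\mathsf{R}(a))+\sum_{\mathrm{tl}(a)=i}(1-\mathsf{R}(a))=2$ for every $i\in Q_0$ ($\mathrm{hd},\mathrm{tl}$ = head, tail). Perfect matchings. A perfect matching of $\Gamma$ is a subset $D\subset\Gamma_1$ such that each node is an endpoint of exactly one edge of $D$; the dual subset $\mathsf{D}\subset Q_1$ is called a perfect matching of $Q$. Orient edges of perfect matchings from white to black and fix a reference perfect matching $D_0$; then $D-D_0$ is a $1$-cycle with class $[D-D_0]\in H_1(\mathbb{T})\cong\mathbb{Z}^2$. The perfect matching polygon is $\Delta=\mathrm{conv}\{[D-D_0]\}\subset\mathbb{R}^2$,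 over all perfect matchings $D$ (changing $D_0$ translates $\Delta$). $D$ corresponds to the lattice point $[D-D_0]$ of $\Delta$, and is internal if this is an interior lattice point of $\Delta$. Mutations. For a perfect matching $\mathsf{D}$ of $Q$, a vertex $k\in Q_0$ is a strict source (resp. strict sink) of $(Q,\mathsf{D})$ if all arrows ending (resp. starting) at $k$ belong to $\mathsf{D}$ and all arrows starting (resp. ending) at $k$ do not belong to $\mathsf{D}$. If $k$ is a strict source, $\lambda_k^+(\mathsf{D})$ is obtained from $\mathsf{D}$ by removing all arrows of $Q$ ending at $k$ and adding all arrows of $Q$ starting at $k$; if $k$ is a strict sink, $\lambda_k^-(\mathsf{D})$ is obtained from $\mathsf{D}$ by removing all arrows of $Q$ starting at $k$ and adding all arrows of $Q$ ending at $k$. These are again perfect matchings of $Q$; they, and the dual perfect matchings $\lambda_k^{\pm}(D)$ of $\Gamma$, are called mutations of the perfect matching at $k$. *)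

(* Defs.v *)
From HB Require Import structures.
From mathcomp Require Import all_boot all_order all_algebra all_fingroup.
From mathcomp Require Import all_classical all_reals all_analysis.

Set Implicit Arguments.
Unset Strict Implicit.
Unset Printing Implicit Defensive.

Import Order.TTheory GRing.Theory Num.Theory.
Import numFieldNormedType.Exports.

Local Open Scope ring_scope.

(* A finite bipartite graph on an oriented closed surface inducing a polygonal
   cell decomposition is encoded, up to orientation-preserving homeomorphism,
   by its rotation system.  [wrot] (resp. [brot]) sends an edge to the next one
   in counterclockwise order around its white (resp. black) end; white nodes,
   black nodes and faces are the cycles of [wrot], [brot] and [wrot * brot].
   A node is represented by the set of edges incident to it (the graph being
   bipartite, an edge meets a node at most once, and multiple edges are
   allowed).  Transitivity says that the surface is connected, which excludes
   the empty graph, and Euler characteristic zero that it is the torus. *)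
Record dimer_model := DimerModel {
  edge :> finType;
  wrot : {perm edge};
  brot : {perm edge};
  dimer_connected :
    [transitive <<[set wrot; brot]>>%g, on [set: edge] | 'P];
  dimer_euler0 :
    (#|porbits wrot| + #|porbits brot| + #|porbits (wrot * brot)%g|
       = #|edge|)%N;
  dimer_no_2valent :
    forall n : {set edge}, n \in porbits wrot :|: porbits brot -> #|n| != 2%N
}.

Section Dimer.
Variable G : dimer_model.

Definition nodes : {set {set G}} := porbits (wrot G) :|: porbits (brot G).

Definition fperm : {perm G} := (wrot G * brot G)%g.

Definition face := {f : {set G} | f \in porbits fperm}.

(* Walking along [e] from its white to its black end with a face on the left,
   and turning at the black end [b] then at the next white end, one follows
   next the edge [(wrot^-1 \o brot^-1) e] in the same direction.  Hence the
   face to the left of [e] is the [fperm]-cycle of [e]; the face to the right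
   of [e] is the face to the left of [wrot^-1 e]. *)
Definition left_face (e : G) : face :=
  exist _ (porbit fperm e) (imset_f _ (isT : e \in predT)).

Definition right_face (e : G) : face := left_face ((wrot G)^-1%g e).

(* The dual quiver: vertices are faces, and arrows are identified with the
   edges they cross.  The arrow crossing [e] has the white end of [e] on its
   right, so it goes from the left to the right of [e] oriented from white to
   black. *)
Definition tl (a : G) : face := left_face a.
Definition hd (a : G) : face := right_face a.

Definition consistent (R : realType) : Prop :=
  exists rc : G -> R,
    [/\ forall a, 0 < rc a,
        forall n, n \in nodes -> \sum_(a in n) rc a = 2
      & forall i : face,
          \sum_(a | hd a == i) (1 - rc a) + \sum_(a | tl a == i) (1 - rc a) = 2].

Definition perfect_matching (D : {set G}) : bool :=
  [forall n in nodes, #|D :&: n| == 1].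

(* Cellular 1-chains of the torus, edges being oriented from white to black:
   the boundary of the edge [e] is its black end minus its white end. *)
Definition chain1 := {ffun G -> int}.

Definition is_cycle (z : chain1) : Prop :=
  forall n, n \in nodes -> \sum_(e in n) z e = 0.

(* The boundary of a 2-chain: faces are oriented counterclockwise, so [e] occurs
   positively in the boundary of the face on its left. *)
Definition bound2 (h : {ffun face -> int}) : chain1 :=
  [ffun e => h (left_face e) - h (right_face e)].

Definition is_boundary (z : chain1) : Prop := exists h, z = bound2 h.

(* [cl] induces an isomorphism from H_1(T), the quotient of 1-cycles by
   boundaries, to Z^2; its values outside 1-cycles are irrelevant. *)
Definition H1_iso (cl : chain1 -> 'rV[int]_2) : Prop :=
  [/\ forall z w, is_cycle z -> is_cycle w -> cl (z + w) = cl z + cl w,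
      forall z, is_cycle z -> (cl z = 0 <-> is_boundary z)
    & forall v, exists2 z, is_cycle z & cl z = v].

Definition chain_of (D : {set G}) : chain1 := [ffun e => (e \in D)%:R].

Section Polygon.
Variables (cl : chain1 -> 'rV[int]_2) (D0 : {set G}).

Definition lattice_point (D : {set G}) : 'rV[int]_2 :=
  cl (chain_of D - chain_of D0).

Definition real_point (R : realType) (v : 'rV[int]_2) : 'rV[R]_2 :=
  map_mx intr v.

Definition pm_polygon (R : realType) : set 'rV[R]_2 :=
  smallest (@convex_set R 'rV[R]_2)
    [set real_point R (lattice_point D) | D in
       [set D | perfect_matching D]]%classic.

Definition internal (R : realType) (D : {set G}) : Prop :=
  perfect_matching D /\ interior (@pm_polygon R) (real_point R (lattice_point D)).

End Polygon.

Definition arrows_in (k : face) : {set G} := [set a | hd a == k].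
Definition arrows_out (k : face) : {set G} := [set a | tl a == k].

Definition strict_source (D : {set G}) (k : face) : bool :=
  (arrows_in k \subset D) && [disjoint arrows_out k & D].

Definition strict_sink (D : {set G}) (k : face) : bool :=
  (arrows_out k \subset D) && [disjoint arrows_in k & D].

Definition mut_source (k : face) (D : {set G}) : {set G} :=
  (D :\: arrows_in k) :|: arrows_out k.

Definition mut_sink (k : face) (D : {set G}) : {set G} :=
  (D :\: arrows_out k) :|: arrows_in k.

Definition mutation : rel {set G} := fun D D' =>
  perfect_matching D &&
  [exists k : face, (strict_source D k && (D' == mut_source k D))
                 || (strict_sink D k && (D' == mut_sink k D))].

Definition mutation_equiv : rel {set G} := connect mutation.

End Dimer.

(* Main.v *)
(* A mutation at [k] changes the chain of a perfect matching by the boundary of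
   the face [k], hence preserves the lattice point.  Conversely, if [D] and [D']
   have the same lattice point, then [D' - D] is the boundary of a height function
   [h], which may be taken nonnegative.  Orient the quiver by reversing the arrows
   in [D]; no arrow then enters the set [S] where [h > 0], and a face of [S]
   without predecessor is a strict source of [D], at which a mutation lowers [h].
   Such a face exists because the reoriented quiver has no oriented cycle:
   pairing with such a cycle gives a linear functional on H_1 whose minimum on the
   polygon is attained at the interior point of [D], so it vanishes; but its value
   on the real cycle [R/2 - D], for an R-charge [R], is positive. *)
Require Import Defs.
From mathcomp Require Import all_boot all_order all_algebra all_fingroup.
From mathcomp Require Import all_classical all_reals all_analysis.
From mathcomp Require Import ring lra zify.
Set Implicit Arguments.
Unset Strict Implicit.
Unset Printing Implicit Defensive.
Import Order.TTheory GRing.Theory Num.Theory.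
Import numFieldNormedType.Exports.
Local Open Scope ring_scope.

(** * Integral points of kernels, and linear functionals on convex hulls *)

Lemma rat_row_clear_denominators (m : nat) (v : 'rV[rat]_m) :
  exists (d : int) (z : 'rV[int]_m), d != 0 /\ map_mx intr z = d%:~R *: v.
Proof.
pose d := \prod_(j < m) denq (v 0 j).
exists d, (map_mx numq (d%:~R *: v)); split.
  by apply/prodf_neq0 => j _; exact: denq_neq0.
apply/rowP => j; rewrite !mxE numqK // Qint_def mulrC.
by rewrite [d](bigD1 j) // rmorphM mulrA -numqE -rmorphM denq_int.
Qed.

(* The kernel of an integer matrix is spanned over any field of characteristic
   zero by its integer points. *)
Lemma int_kernel_scalar_extension (F : numFieldType) (m n : nat)
    (A : 'M[int]_(m, n)) (w : 'cV[int]_m) :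
    (forall z : 'rV[int]_m, z *m A = 0 -> z *m w = 0) ->
  forall x : 'rV[F]_m, x *m map_mx intr A = 0 -> x *m map_mx intr w = 0.
Proof.
move=> Aw x xA.
pose Aq : 'M[rat]_(m, n) := map_mx intr A.
pose wq : 'cV[rat]_m := map_mx intr w.
have ratrint k l (B : 'M[int]_(k, l)) :
    map_mx (@ratr F) (map_mx intr B) = map_mx intr B.
  by rewrite -map_mx_comp; apply/matrixP => i j; rewrite !mxE /= ratr_int.
have kw : kermx Aq *m wq = 0.
  apply/row_matrixP => i; rewrite row_mul row0.
  have [d [z [d0 Ez]]] := rat_row_clear_denominators (row i (kermx Aq)).
  have zA : z *m A = 0.
    have : map_mx (intr : int -> rat) (z *m A) = 0.
      by rewrite map_mxM Ez -scalemxAl -row_mul mulmx_ker row0 scaler0.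
    move/matrixP => zA; apply/matrixP => k l; have := zA k l.
    by rewrite !mxE => /eqP; rewrite intr_eq0 => /eqP.
  have /(congr1 (map_mx (intr : int -> rat))) := Aw _ zA.
  rewrite map_mxM map_mx0 Ez -scalemxAl => /eqP.
  by rewrite scaler_eq0 intr_eq0 (negPf d0) => /eqP.
(* Kernels commute with field extension, so [x] is an [F]-combination of the rows of the rational
   kernel. *)
have /sub_kermxP := xA; rewrite -ratrint -map_kermx => /submxP[y ->].
by rewrite -ratrint -mulmxA -map_mxM kw map_mx0 mulmx0.
Qed.

Lemma int_functional_kernel_extension (F : numFieldType) (E N : finType)
    (A : E -> N -> int) (w : E -> int) :
    (forall z : {ffun E -> int}, (forall n, \sum_e z e * A e n = 0) ->
       \sum_e w e * z e = 0) ->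
  forall x : E -> F, (forall n, \sum_e x e * (A e n)%:~R = 0) ->
    \sum_e (w e)%:~R * x e = 0.
Proof.
move=> Aw x xA.
have sumE (T : nmodType) (f : E -> T) :
    \sum_e f e = \sum_(i < #|E|) f (enum_val i).
  by rewrite (big_enum_val (A := E)) /=.
pose M : 'M[int]_(#|E|, #|N|) := \matrix_(i, j) A (enum_val i) (enum_val j).
pose c : 'cV[int]_#|E| := \col_i w (enum_val i).
have kill (z : 'rV[int]_#|E|) : z *m M = 0 -> z *m c = 0.
  move=> zM; apply/matrixP => i j; rewrite !ord1 !mxE.
  rewrite -[RHS](Aw [ffun e => z 0 (enum_rank e)]).
    by rewrite sumE; apply: eq_bigr => k _; rewrite !mxE ffunE enum_valK mulrC.
  move=> n; have /matrixP/(_ 0 (enum_rank n)) := zM; rewrite !mxE => {2}<-.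
  by rewrite sumE; apply: eq_bigr => k _; rewrite !mxE ffunE enum_valK enum_rankK.
have := @int_kernel_scalar_extension F _ _ M c kill (\row_i x (enum_val i)).
move=> /(_ _)/matrixP/(_ 0 0); rewrite !mxE => {2}<-.
  by rewrite sumE; apply: eq_bigr => k _; rewrite !mxE mulrC.
apply/matrixP => i j; rewrite !mxE -[RHS](xA (enum_val j)) sumE.
by apply: eq_bigr => k _; rewrite !mxE.
Qed.

(** The half-space cut out by [u] at [p] is convex and contains [A], hence the hull. A small step
    from [p] along [-u] stays in the hull, yet lowers the functional by a multiple of the squared
    norm of [u]. *)
Lemma interior_hull_min_functional (R : realType) (m : nat)
    (A : set 'rV[R]_m.+1) (p u : 'rV[R]_m.+1) :
    interior (smallest (@convex_set R 'rV[R]_m.+1) A) p ->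
    (forall v, A v -> 0 <= \sum_j u 0 j * (v 0 j - p 0 j)) ->
  u = 0.
Proof.
move=> ip Au.
pose f (v : 'rV[R]_m.+1) := \sum_j u 0 j * (v 0 j - p 0 j).
have sub : (smallest (@convex_set R 'rV[R]_m.+1) A
    `<=` [set v | 0 <= f v])%classic.
  apply: smallest_sub => [|v /Au//] x y l.
  rewrite !inE /= => fx fy.
  have -> : f (conv l x y) = l%:num * f x + (1 - l%:num) * f y.
    rewrite /f !mulr_sumr -big_split /=; apply: eq_bigr => j _.
    have -> : conv l x y 0 j = l%:num * x 0 j + (1 - l%:num) * y 0 j.
      by rewrite /conv /= !mxE.
    ring.
  by rewrite addr_ge0 ?mulr_ge0 // subr_ge0.
move: ip; rewrite /interior => /nbhs_ballP[/= e e0 pe].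
(* [M] strictly exceeds every entry of [u] in absolute value, so a step of [(e / M) *: u] stays in
   the sup-norm ball of radius [e]. *)
pose M := 1 + \sum_j `|u 0 j|.
have M0 : 0 < M by rewrite ltr_pwDl // sumr_ge0.
have t0 : 0 < e / M by rewrite divr_gt0.
have /pe/sub/= : ball p e (p - (e / M) *: u).
  split=> [//|i j]; rewrite /ball /= !mxE opprB addrC subrK ord1.
  rewrite normrM gtr0_norm // mulrAC ltr_pdivrMr // ltr_pM2l //.
  by rewrite /M (bigD1 j) //= ltr_pwDl // lerDl sumr_ge0.
rewrite /f (eq_bigr (fun j => - (e / M) * (u 0 j ^+ 2))); last first.
  by move=> j _; rewrite !mxE; ring.
rewrite -mulr_sumr mulNr oppr_ge0 pmulr_rle0 // => u2.
have /eqP : \sum_j u 0 j ^+ 2 = 0.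
  by apply/eqP; rewrite eq_le u2 sumr_ge0 // => j _; exact: sqr_ge0.
rewrite psumr_eq0 => [|j _]; last exact: sqr_ge0.
move/allP => u0; apply/rowP => j; have := u0 j (mem_index_enum _).
by rewrite sqrf_eq0 !mxE => /eqP.
Qed.

(** * Cycles, boundaries and perfect matchings as chains *)

Lemma porbit_apply (T : finType) (s : {perm T}) (x : T) :
  porbit s (s x) = porbit s x.
Proof. exact: (porbit_perm s 1 x). Qed.

Lemma big_porbit_perm (T : finType) (s : {perm T}) (x : T) (V : nmodType)
    (F : T -> V) :
  \sum_(e in porbit s x) F (s e) = \sum_(e in porbit s x) F e.
Proof.
rewrite [RHS](reindex_inj (@perm_inj _ s)) /=; apply: eq_bigl => e.
by rewrite -!eq_porbit_mem porbit_apply.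
Qed.

Section DimerModel.
Variable G : dimer_model.

Lemma left_face_brot (e : G) : left_face (brot G e) = right_face e.
Proof.
apply/val_inj => /=.
have -> : brot G e = fperm G (((wrot G)^-1)%g e) by rewrite permM permKV.
exact: porbit_apply.
Qed.

Lemma right_face_wrot (e : G) : right_face (wrot G e) = left_face e.
Proof. by rewrite /right_face permK. Qed.

(** Heights cancel around a node: the left face of an edge is the right face of the next edge at its
    white end, and the right face is the left face of the next edge at its black end. *)
Lemma bound2_is_cycle (h : {ffun face G -> int}) : is_cycle (bound2 h).
Proof.
move=> n; rewrite inE => /orP[] /imsetP[x _ ->].
  under eq_bigr do rewrite ffunE; rewrite sumrB; apply/eqP; rewrite subr_eq0.
  rewrite -(big_porbit_perm _ x (fun e => h (right_face e))).
  by apply/eqP/eq_bigr => e _; rewrite right_face_wrot.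
under eq_bigr do rewrite ffunE; rewrite sumrB; apply/eqP; rewrite subr_eq0.
rewrite -(big_porbit_perm _ x (fun e => h (left_face e))).
by apply/eqP/eq_bigr => e _; rewrite left_face_brot.
Qed.

Lemma bound2D (h g : {ffun face G -> int}) : bound2 (h + g) = bound2 h + bound2 g.
Proof. by apply/ffunP => e; rewrite !ffunE; ring. Qed.

Lemma bound2_const (c : int) : bound2 [ffun _ => c] = 0 :> chain1 G.
Proof. by apply/ffunP => e; rewrite !ffunE subrr. Qed.

Lemma is_cycleD (z w : chain1 G) : is_cycle z -> is_cycle w -> is_cycle (z + w).
Proof.
move=> cz cw n nG; under eq_bigr do rewrite ffunE.
by rewrite big_split /= cz ?cw ?addr0.
Qed.

Lemma is_cycleN (z : chain1 G) : is_cycle z -> is_cycle (- z).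
Proof.
by move=> cz n nG; under eq_bigr do rewrite ffunE; rewrite sumrN cz ?oppr0.
Qed.

Lemma is_cycle0 : is_cycle (0 : chain1 G).
Proof. by move=> n _; rewrite big1 // => e _; rewrite ffunE. Qed.

Lemma is_cycleMz (z : chain1 G) (k : int) : is_cycle z -> is_cycle (z *~ k).
Proof.
move=> cz; have cMn n : is_cycle (z *+ n).
  elim: n => [|n IHn]; first by rewrite mulr0n; exact: is_cycle0.
  by rewrite mulrS; exact: is_cycleD.
by case: k => n; [exact: cMn|exact/is_cycleN/cMn].
Qed.

Lemma is_cycle_sum (I : Type) (r : seq I) (z : I -> chain1 G) :
  (forall i, is_cycle (z i)) -> is_cycle (\sum_(i <- r) z i).
Proof.
by move=> cz; elim/big_rec: _ => [|i x _]; [exact: is_cycle0|exact: is_cycleD].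
Qed.

Lemma sum_chain_of (D n : {set G}) : \sum_(e in n) chain_of D e = #|D :&: n|%:R.
Proof.
under eq_bigr do rewrite ffunE.
rewrite -natr_sum -sum1_card [in RHS](eq_bigl (fun e => (e \in n) && (e \in D))).
  by rewrite big_mkcondr; congr (_%:R); apply: eq_bigr => e _; case: (e \in D).
by move=> e; rewrite inE andbC.
Qed.

Lemma perfect_matchingP (D : {set G}) :
  reflect (forall n, n \in nodes G -> \sum_(e in n) chain_of D e = 1)
          (perfect_matching D).
Proof.
apply: (iffP forall_inP) => DP n nG.
  by rewrite sum_chain_of (eqP (DP n nG)).
by have /eqP := DP n nG; rewrite sum_chain_of pnatr_eq1.
Qed.

Lemma perfect_matching_diff_cycle (D D' : {set G}) :
    perfect_matching D ->
  perfect_matching D' <-> is_cycle (chain_of D' - chain_of D).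
Proof.
move=> /perfect_matchingP DP.
have sumB n : \sum_(e in n) (chain_of D' - chain_of D) e =
    \sum_(e in n) chain_of D' e - \sum_(e in n) chain_of D e.
  by rewrite -sumrB; apply: eq_bigr => e _; rewrite ffunE [X in _ + X]ffunE.
split=> [/perfect_matchingP DP' n nG|cz].
  by rewrite sumB DP ?DP' ?subrr.
apply/perfect_matchingP => n nG; apply/eqP.
by rewrite -subr_eq0 -(DP n nG) -sumB cz.
Qed.

(** Edges with [k] on the left are outgoing arrows and get added, those with [k] on the right are
    incoming and get removed; no edge has a strict source on both sides. *)
Lemma mut_source_chain (D : {set G}) (k : face G) : strict_source D k ->
  chain_of (mut_source k D) = chain_of D + bound2 [ffun i => (i == k)%:R].
Proof.
move=> /andP[/fintype.subsetP inD outD]; apply/ffunP => e; rewrite !ffunE !inE.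
have := inD e; rewrite inE /tl /hd.
have : left_face e == k -> e \in D = false.
  by move=> tk; apply: (disjointFr outD); rewrite inE.
by case: (left_face e == k); case: (right_face e == k); case: (e \in D);
  move=> //= outF inT; first [by have := outF isT | by have := inT isT].
Qed.

Lemma mut_sink_chain (D : {set G}) (k : face G) : strict_sink D k ->
  chain_of (mut_sink k D) = chain_of D + bound2 [ffun i => - (i == k)%:R].
Proof.
move=> /andP[/fintype.subsetP inD outD]; apply/ffunP => e; rewrite !ffunE !inE.
have := inD e; rewrite inE /tl /hd.
have : right_face e == k -> e \in D = false.
  by move=> tk; apply: (disjointFr outD); rewrite inE.
by case: (left_face e == k); case: (right_face e == k); case: (e \in D);
  move=> //= inF outT; first [by have := inF isT | by have := outT isT].
Qed.

(** * Homology classes and functionals on cycles *)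

Section Homology.
Variable cl : chain1 G -> 'rV[int]_2.
Hypothesis clP : H1_iso cl.

Lemma clD (z w : chain1 G) : is_cycle z -> is_cycle w -> cl (z + w) = cl z + cl w.
Proof. by case: clP => + _ _; apply. Qed.

Lemma cl_eq0 (z : chain1 G) : is_cycle z -> cl z = 0 <-> is_boundary z.
Proof. by case: clP => _ + _; apply. Qed.

Lemma cl0 : cl 0 = 0.
Proof.
by apply: (addrI (cl 0)); rewrite -clD ?addr0 //; exact: is_cycle0.
Qed.

Lemma clN (z : chain1 G) : is_cycle z -> cl (- z) = - cl z.
Proof.
move=> cz; apply: (addrI (cl z)).
by rewrite -clD ?subrr ?cl0 //; exact: is_cycleN.
Qed.

Lemma clMz (z : chain1 G) (k : int) : is_cycle z -> cl (z *~ k) = cl z *~ k.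
Proof.
move=> cz; have cMn n : cl (z *+ n) = cl z *+ n.
  elim: n => [|n IHn]; first by rewrite !mulr0n cl0.
  by rewrite !mulrS clD ?IHn //; exact: (@is_cycleMz z n).
case: k => n; first exact: cMn.
by rewrite -[LHS]/(cl (- (z *+ n.+1))) clN ?cMn //; exact: (@is_cycleMz z n.+1).
Qed.

Lemma cl_sum (I : Type) (r : seq I) (z : I -> chain1 G) :
  (forall i, is_cycle (z i)) -> cl (\sum_(i <- r) z i) = \sum_(i <- r) cl (z i).
Proof.
move=> cz; elim: r => [|i r IHr]; first by rewrite !big_nil cl0.
by rewrite !big_cons clD ?IHr //; exact: is_cycle_sum.
Qed.

(** Lift the standard basis to cycles [Z j]. Any cycle differs from the combination of the [Z j]
    with the same class by a boundary, on which [w] vanishes. *)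
Lemma functional_factors_cl (w : G -> int) :
    (forall h, \sum_e w e * bound2 h e = 0) ->
  exists u : 'rV[int]_2, forall z, is_cycle z ->
    \sum_e w e * z e = \sum_j u 0 j * cl z 0 j.
Proof.
move=> wb; pose phi (z : chain1 G) := \sum_e w e * z e.
have phiD z z' : phi (z + z') = phi z + phi z'.
  by rewrite -big_split; apply: eq_bigr => e _; rewrite ffunE mulrDr.
have phi0 : phi 0 = 0 by apply: (addrI (phi 0)); rewrite -phiD !addr0.
have phiN z : phi (- z) = - phi z.
  by apply: (addrI (phi z)); rewrite -phiD !subrr.
have phiMz z (k : int) : phi (z *~ k) = phi z *~ k.
  have phiMn n : phi (z *+ n) = phi z *+ n.
    by elim: n => [|n IHn]; rewrite ?mulr0n // !mulrS phiD IHn.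
  case: k => n; first exact: phiMn.
  by rewrite -[LHS]/(phi (- (z *+ n.+1))) phiN phiMn.
have [_ _ surj] := clP.
have /boolp.choice[Z ZP] (j : 'I_2) :
    exists z, is_cycle z /\ cl z = delta_mx 0 j.
  by have [z cz clz] := surj (delta_mx 0 j); exists z.
have cZ j := proj1 (ZP j); have clZ j := proj2 (ZP j).
exists (\row_j phi (Z j)) => z cz.
pose y := \sum_j Z j *~ cl z 0 j.
have cy : is_cycle y by apply: is_cycle_sum => j; exact: is_cycleMz.
have cly : cl y = cl z.
  rewrite cl_sum => [|j]; last exact: is_cycleMz.
  rewrite [RHS]row_sum_delta; apply: eq_bigr => j _.
  by rewrite clMz // clZ -scaler_int intz.
have /cl_eq0 [] : is_cycle (z - y) by apply: is_cycleD => //; exact: is_cycleN.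
rewrite clD ?clN ?cly ?subrr // => [/(_ erefl)[h zy] _|]; last exact: is_cycleN.
have : phi (z - y) = 0 by rewrite zy; exact: wb.
rewrite phiD phiN => /eqP; rewrite subr_eq0 => /eqP.
rewrite -/(phi z) => ->; rewrite /y (big_morph phi phiD phi0).
by apply: eq_bigr => j _; rewrite phiMz mxE -mulrzr intz.
Qed.

End Homology.

(* An edge with charge 2 would be the only edge at both of its ends, and would
   then bound a face violating the face condition. *)
Lemma rcharge_lt2 (R : realType) (rc : G -> R) :
    (forall a, 0 < rc a) ->
    (forall n, n \in nodes G -> \sum_(a in n) rc a = 2) ->
    (forall i : face G,
       \sum_(a | hd a == i) (1 - rc a) + \sum_(a | tl a == i) (1 - rc a) = 2) ->
  forall e, rc e < 2.
Proof.
move=> rc0 rcn rcf e; rewrite ltNge; apply/negP => rce.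
have fixed (s : {perm G}) : porbit s e \in nodes G -> s e = e.
  move=> /rcn; rewrite (bigD1 e) ?porbit_id //=.
  have [//|se] := eqVneq (s e) e.
  rewrite (bigD1 (s e)) /= => [rc2|]; last first.
    by rewrite se -eq_porbit_mem porbit_apply eqxx.
  have rest : 0 <= \sum_(a | (a \in porbit s e) && (a != e) && (a != s e)) rc a.
    by apply: sumr_ge0 => a _; exact: ltW.
  by exfalso; have := rc0 (s e); lra.
have we : wrot G e = e.
  by apply: fixed; rewrite inE /porbits imset_f.
have be : brot G e = e.
  by apply: fixed; rewrite inE /porbits imset_f // orbT.
have tlE a : (tl a == left_face e) = (a == e).
  have fe : fperm G e = e by rewrite permM we be.
  rewrite -val_eqE /= eq_porbit_mem; apply/porbitP/eqP => [[i ->]|->].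
    by rewrite permX iter_fix.
  by exists 0%N; rewrite perm1.
have hdE a : (hd a == left_face e) = (a == e).
  by rewrite /hd -left_face_brot [LHS]tlE -{1}be (inj_eq perm_inj).
(* As [e] is the only arrow into and the only arrow out of this face, the condition reads
   [2 * (1 - rc e) = 2]. *)
have := rcf (left_face e).
by rewrite (eq_bigl _ _ hdE) (eq_bigl _ _ tlE) !big_pred1_eq; lra.
Qed.

(** * Acyclicity of the reoriented quiver at an internal matching *)

Section Circulation.
Variables (R : realType) (cl : chain1 G -> 'rV[int]_2) (D0 D : {set G}).
Hypotheses (consG : consistent G R) (clP : H1_iso cl).
Hypotheses (D0P : perfect_matching D0) (Dint : internal cl D0 R D).

Lemma lattice_pointB (A B : {set G}) :
    perfect_matching A -> perfect_matching B ->
  lattice_point cl D0 A - lattice_point cl D0 B = cl (chain_of A - chain_of B).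
Proof.
move=> AP BP.
have cA : is_cycle (chain_of A - chain_of D0) by apply/perfect_matching_diff_cycle.
have cB : is_cycle (chain_of B - chain_of D0) by apply/perfect_matching_diff_cycle.
rewrite /lattice_point -clN // -clD //; last exact: is_cycleN.
by rewrite opprB addrA subrK.
Qed.

(* Such a [w] factors through [cl] as a linear functional which is minimal on the
   polygon at the interior point of [D], so it kills all integral, hence all real,
   cycles; among these is half the R-charge minus [D], whose pairing with [w] is a
   sum of nonnegative terms. *)
Lemma internal_no_signed_circulation (w : G -> int) :
    (forall h, \sum_e w e * bound2 h e = 0) ->
    (forall e, e \notin D -> 0 <= w e) -> (forall e, e \in D -> w e <= 0) ->
  forall e, w e = 0.
Proof.
move=> wb wpos wneg; have [u uP] := functional_factors_cl clP wb.
have [rc [rc0 rcn rcf]] := consG; have rc2 := rcharge_lt2 rc0 rcn rcf.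
have [DP pint] := Dint.
have u0 : u = 0.
  suff : map_mx intr u = 0 :> 'rV[R]_2.
    move=> /matrixP u0; apply/matrixP => i j; apply/eqP.
    by have /eqP := u0 i j; rewrite !mxE intr_eq0.
  apply: (interior_hull_min_functional pint) => _ [B /= BP <-].
  have -> : \sum_j (map_mx intr u : 'rV[R]_2) 0 j *
      (real_point R (lattice_point cl D0 B) 0 j -
       real_point R (lattice_point cl D0 D) 0 j) =
      (\sum_e w e * (chain_of B - chain_of D) e)%:~R.
    rewrite uP; last exact/perfect_matching_diff_cycle.
    rewrite -lattice_pointB // rmorph_sum /=; apply: eq_bigr => j _.
    by rewrite !mxE rmorphM rmorphB.
  (* The difference of [B] and [D] is nonpositive on [D] and nonnegative off [D], like [w]. *)
  rewrite ler0z; apply: sumr_ge0 => e _; rewrite !ffunE.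
  have [eD|eD] := boolP (e \in D).
    by rewrite mulr_le0 ?wneg // subr_le0; case: (e \in B).
  by rewrite subr0 mulr_ge0 ?wpos //; case: (e \in B).
(* As [0 < rc e < 2], [x] is negative on [D] and positive off [D]; its vanishing pairing with [w]
   thus forces every [w e] to vanish. *)
pose x e := rc e / 2 - (e \in D)%:R.
have : \sum_e (w e)%:~R * x e = 0.
  (* Incidence matrix with columns indexed by all edge sets; those that are not nodes give zero
     columns. *)
  pose A e (n : {set G}) : int := ((n \in nodes G) && (e \in n))%:R.
  have sumA (T : pzRingType) (z : G -> T) n : n \in nodes G ->
      \sum_e z e * (A e n)%:~R = \sum_(e in n) z e.
    move=> nG; rewrite [RHS]big_mkcond; apply: eq_bigr => e _.
    by rewrite /A nG; case: (e \in n); rewrite ?mulr1 ?mulr0.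
  apply: (@int_functional_kernel_extension R G {set G} A w) => [z zA|n].
    rewrite uP ?u0; first by rewrite big1 // => j _; rewrite mxE mul0r.
    move=> n nG; rewrite -(sumA _ z n nG) -[RHS](zA n).
    by apply: eq_bigr => e _; rewrite intz.
  have [nG|nG] := boolP (n \in nodes G); last first.
    by rewrite big1 // => e _; rewrite /A (negPf nG) mulr0.
  rewrite sumA // sumrB -mulr_suml rcn // divff ?pnatr_eq0 //.
  have /perfect_matchingP/(_ n nG) := DP.
  move=> /(congr1 (intr : int -> R)); rewrite rmorph_sum rmorph1 => sD.
  apply/eqP; rewrite subr_eq0 -sD; apply/eqP/eq_bigr => e _.
  by rewrite ffunE; case: (e \in D).
move=> /eqP; rewrite psumr_eq0 => [|e _]; last first.
  have := rc0 e; have := rc2 e; rewrite /x.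
  have [eD|eD] := boolP (e \in D) => rce2 rce0.
    by rewrite mulr_le0 ?lerz0 ?wneg //= mulr1n; lra.
  by rewrite mulr_ge0 ?ler0z ?wpos //= mulr0n; lra.
move=> /allP w0 e; have := w0 e (mem_index_enum _).
rewrite mulf_eq0 intr_eq0 => /orP[/eqP//|].
have := rc0 e; have := rc2 e; rewrite /x.
case: (e \in D) => /= rce2 rce0 /eqP xe; exfalso; move: xe;
  by rewrite ?mulr1n ?mulr0n; lra.
Qed.

(** The two hypotheses say that no reoriented arrow enters [S]. Without a strict source in [S],
    predecessors could be followed inside [S] forever, closing up into a forbidden circulation. *)
Lemma exists_strict_source (S : {set face G}) : S != finset.set0 ->
    (forall e, left_face e \in S -> right_face e \notin S -> e \notin D) ->
    (forall e, right_face e \in S -> left_face e \notin S -> e \in D) ->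
  exists2 k, k \in S & strict_source D k.
Proof.
move=> S0 Sout Sin; apply/exists_inP; apply: contraT.
rewrite negb_exists_in => /forall_inP nosource.
(* Arrows in [D] are traversed backwards. *)
pose sgn e : int := if e \in D then -1 else 1.
pose src e := if e \in D then right_face e else left_face e.
pose tgt e := if e \in D then left_face e else right_face e.
have predS k : k \in S -> exists e, tgt e = k /\ src e \in S.
  move=> kS; have := nosource k kS; rewrite negb_and => /orP[/subsetPn|].
    move=> [e + eD]; rewrite inE => /eqP hde; exists e.
    rewrite /tgt /src (negPf eD); split=> //.
    by apply: contraNT eD => /Sin; apply; rewrite -[right_face e]/(hd e) hde.
  move=> /pred0Pn[e /andP[]]; rewrite /= inE => /eqP tle eD; exists e.
  rewrite /tgt /src eD; split=> //.
  by apply: contraLR eD => /Sout; apply; rewrite -[left_face e]/(tl e) tle.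
(* Faces outside [S] receive a dummy arrow [e0], so that a total choice function exists. *)
have pred k : exists e, k \in S -> tgt e = k /\ src e \in S.
  have /finset.set0Pn[k0 /predS[e0 _]] := S0.
  have [/predS[e eP]|_] := boolP (k \in S); first by exists e.
  by exists e0.
have [eps epsP] := boolp.choice pred.
pose f k := src (eps k).
(* [f] permutes a minimal nonempty stable set [C], so the arrows [eps k], [k] in
   [C], carry a signed circulation. *)
pose stable C := [&& C != finset.set0, C \subset S & f @: C \subset C].
have stS : stable S.
  rewrite /stable S0 subxx; apply/fintype.subsetP => _ /imsetP[k kS ->].
  by have [] := epsP k kS.
have [C /minsetP[/and3P[C0 CS fC] Cmin] _] := minset_exists stS.
have fCE : f @: C = C.
  apply: Cmin => //; rewrite /stable imsetS // (fintype.subset_trans fC) // !andbT.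
  have /finset.set0Pn[k kC] := C0.
  by apply/finset.set0Pn; exists (f k); exact: imset_f.
have finj : {in C &, injective f} by apply/imset_injP; rewrite fCE.
pose w e := sgn e * #|[set k in C | eps k == e]|%:R.
have w0 : forall e, w e = 0.
  apply: internal_no_signed_circulation => [h|e eD|e eD]; last 2 first.
  - by rewrite /w /sgn (negPf eD) mul1r.
  - by rewrite /w /sgn eD mulN1r oppr_le0.
  (* Grouping the faces of [C] by their chosen arrow turns the pairing into this sum, which vanishes
     because [f] permutes [C]. *)
  transitivity (\sum_(k in C) (h (f k) - h k)).
    rewrite (partition_big eps predT) //=; apply: eq_bigr => e _.
    have sgnE : sgn e * bound2 h e = h (src e) - h (tgt e).
      by rewrite /sgn /src /tgt ffunE; case: (e \in D); ring.
    rewrite (eq_bigr (fun=> sgn e * bound2 h e)).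
      by rewrite sumr_const -mulr_natr /w cardsE mulrAC.
    move=> k /andP[kC /eqP ke]; rewrite sgnE -ke.
    by have [-> _] := epsP k (fintype.subsetP CS k kC).
  rewrite sumrB -{2}fCE big_imset //=.
  by rewrite subrr.
have /finset.set0Pn[k kC] := C0.
have /eqP := w0 (eps k); rewrite mulf_eq0 pnatr_eq0 cards_eq0.
case/orP; first by rewrite /sgn; case: ifP.
by move/eqP/finset.setP/(_ k); rewrite !inE kC eqxx.
Qed.

End Circulation.

(** * Mutations and height functions *)

Lemma mutation_boundary (D D' : {set G}) : mutation D D' ->
  exists h, chain_of D' = chain_of D + bound2 h.
Proof.
move=> /andP[_ /existsP[k /orP[] /andP[kD /eqP ->]]].
  by eexists; exact: mut_source_chain.
by eexists; exact: mut_sink_chain.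
Qed.

Lemma mutation_equiv_boundary (D D' : {set G}) : mutation_equiv D D' ->
  exists h, chain_of D' = chain_of D + bound2 h.
Proof.
move=> /connectP[p + ->]; elim: p D => [|B p IHp] D /=.
  by exists [ffun _ => 0]; rewrite bound2_const addr0.
move=> /andP[/mutation_boundary[h hE] /IHp[g ->]].
by exists (h + g); rewrite hE bound2D addrA.
Qed.

Lemma chain_of_inj : injective (@chain_of G).
Proof.
move=> A B AB; apply/finset.setP => e; have /ffunP/(_ e) := AB.
by rewrite !ffunE; case: (e \in A); case: (e \in B).
Qed.

Section Connectivity.
Variables (R : realType) (cl : chain1 G -> 'rV[int]_2) (D0 : {set G}).
Hypotheses (consG : consistent G R) (clP : H1_iso cl).
Hypotheses (D0P : perfect_matching D0).

Lemma internal_mut_source (D : {set G}) (k : face G) :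
  internal cl D0 R D -> strict_source D k -> internal cl D0 R (mut_source k D).
Proof.
move=> [DP pint] /mut_source_chain E.
have diffE : chain_of (mut_source k D) - chain_of D =
    bound2 [ffun i => (i == k)%:R] by rewrite E addrC addKr.
have mP : perfect_matching (mut_source k D).
  by apply/(perfect_matching_diff_cycle _ DP); rewrite diffE; exact: bound2_is_cycle.
split=> //; suff -> : lattice_point cl D0 (mut_source k D) = lattice_point cl D0 D.
  by [].
apply/eqP; rewrite -subr_eq0 (lattice_pointB clP) // diffE; apply/eqP.
by apply/(cl_eq0 clP); [exact: bound2_is_cycle|exists [ffun i => (i == k)%:R]].
Qed.

(** Induction on the total height: mutating at a strict source of positive height lowers it by
    one. *)
Lemma height_mutation_equiv (h : {ffun face G -> nat}) (D D' : {set G}) :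
    internal cl D0 R D ->
    chain_of D' = chain_of D + bound2 [ffun i => (h i)%:Z] ->
  mutation_equiv D D'.
Proof.
have [n] := ubnP (\sum_i h i); elim: n h D => // n IHn h D hn Dint E.
pose S := [set i | (0 < h i)%N].
have [S0|S0] := eqVneq S finset.set0.
  suff -> : D' = D by exact: connect0.
  apply: chain_of_inj; rewrite E [X in bound2 X](_ : _ = [ffun=> 0]).
    by rewrite bound2_const addr0.
  apply/ffunP => i; rewrite !ffunE.
  by have /finset.setP/(_ i) := S0; rewrite !inE lt0n => /negbFE/eqP ->.
have Ee e : (e \in D')%:Z =
    (e \in D)%:Z + ((h (left_face e))%:Z - (h (right_face e))%:Z).
  by have /ffunP/(_ e) := E; rewrite !ffunE !natz.
have [k kS kD] : exists2 k, k \in S & strict_source D k.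
  (* Across the border of [S] the height jumps by at least one, while the chains of [D] and [D']
     take values 0 and 1; this fixes whether [e] lies in [D]. *)
  apply: (exists_strict_source consG clP D0P Dint S0) => e; rewrite !inE;
    have := Ee e; case: (e \in D); case: (e \in D') => //=; lia.
pose g : {ffun face G -> nat} := [ffun i => (h i - (i == k))%N].
have gE i : h i = (g i + (i == k))%N.
  by rewrite ffunE; case: eqP kS => [<-|]; rewrite inE /=; lia.
apply: (@connect_trans _ _ (mut_source k D)); last first.
  apply: (IHn g); last 2 first.
  - exact: internal_mut_source.
  - rewrite E mut_source_chain // -addrA -bound2D; congr (_ + bound2 _).
    by apply/ffunP => i; rewrite !ffunE -/(g i) gE ffunE; lia.
  have : (\sum_i h i = \sum_i g i + 1)%N.
    rewrite (eq_bigr _ (fun i _ => gE i)) big_split /=; congr (_ + _)%N.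
    by rewrite (bigD1 k) //= eqxx big1 // => i /negPf ->.
  by lia.
apply: connect1; rewrite /mutation Dint.1 /=; apply/existsP; exists k.
by rewrite kD eqxx.
Qed.

End Connectivity.

End DimerModel.

Theorem theorem1p8 (R : realType) (G : dimer_model)
  (cl : chain1 G -> 'rV[int]_2) (D0 D D' : {set G}) :
  consistent G R -> H1_iso cl -> perfect_matching D0 ->
  internal cl D0 R D -> internal cl D0 R D' ->
  (mutation_equiv D D' <-> lattice_point cl D0 D = lattice_point cl D0 D').
Proof.
move=> consG clP D0P Dint Dint'; have [DP _] := Dint; have [DP' _] := Dint'.
have cDD' : is_cycle (chain_of D' - chain_of D).
  exact/perfect_matching_diff_cycle.
have -> : (lattice_point cl D0 D = lattice_point cl D0 D') <->
    is_boundary (chain_of D' - chain_of D).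
  rewrite -(cl_eq0 clP cDD') -(lattice_pointB clP D0P DP' DP).
  by split=> [->|/eqP]; rewrite ?subrr // subr_eq0 => /eqP.
split=> [/mutation_equiv_boundary[h hE]|[h hE]].
  by exists h; rewrite hE addrC addKr.
(* A constant shift leaves the boundary unchanged, and [m] is large enough to make every height
   nonnegative. *)
pose m := (\sum_i `|h i|)%N.
have mh i : (0 <= h i + m%:Z).
  by rewrite /m (bigD1 i) //=; lia.
pose k : {ffun face G -> nat} := [ffun i => absz (h i + m%:Z)].
apply: (height_mutation_equiv consG clP D0P (h := k) Dint).
rewrite -[LHS](subrK (chain_of D)) addrC hE; congr (_ + _).
by apply/ffunP => e; rewrite !ffunE !gez0_abs //; ring.
Qed.
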